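(* Let $f_\nabla=\frac12c(T)\nabla n\cdot\nabla n$ be the gradient contribution to the Helmholtz free energy density, with $c(T)$ the influence parameter defined in the context. Then $f_\nabla$ is always convex with respect to the molar density $n$. Moreover, $f_\nabla$ is concave with respect to the temperature $T$ if we take the temperature such that $$(1+m)\big(\beta_1(1-T_r)+\beta_2\big)+4\beta_1T_r\big(1+m(1-\sqrt{T_r})\big)\le 0,$$ where $T_r=T/T_c$.
   Context: A pure substance fluid is considered, with molar density $n$ and absolute temperature $T$. Constants: ideal gas constant $R$, critical temperature $T_c$, critical pressure $P_c$, acentric factor $\omega$. Put $T_r=T/T_c$ (reduced temperature). The energy parameter $a$ and covolume $b$ of the Peng-Robinson equation of state are $$a(T)=0.45724\frac{R^2T_c^2}{P_c}\big[1+m(1-\sqrt{T_r})\big]^2,\qquad b=0.07780\frac{RT_c}{P_c},$$ where $m=0.37464+1.54226\omega-0.26992\omega^2$ if $\omega\le 0.49$ and $m=0.379642+1.485030\omega-0.164423\omega^2+0.016666\omega^3$ if $\omega>0.49$. The influence parameter, which depends on temperature but not on molar density, is $$c(T)=a(T)b^{2/3}\big[\beta_1(1-T_r)+\beta_2\big],\qquad \beta_1=-\frac{10^{-16}}{1.2326+1.3757\omega},\quad \beta_2=\frac{10^{-16}}{0.9051+1.5410\omega}.$$ The parameter $\beta_1$ is negative, while the remaining parameters $m$, $\beta_2$ and $T_r$ are positive.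
   Formalization: Convexity in n is stated only when ω ≤ 3275/1653 (≈1.98) or β₁(1−T_r)+β₂ ≥ 0; otherwise, e.g. ω = 3 and T small, c(T) < 0 and f_∇ is not convex in n. *)

(* Defs.v *)
From HB Require Import structures.
From mathcomp Require Import all_boot all_order all_algebra.
From mathcomp Require Import all_classical all_reals all_analysis.
Import Order.TTheory GRing.Theory Num.Theory.
Import numFieldNormedType.Exports.

Set Implicit Arguments.
Unset Strict Implicit.
Unset Printing Implicit Defensive.

Local Open Scope classical_set_scope.
Local Open Scope ring_scope.

Definition concave_function (K : realType) (E : lmodType K)
    (D : set (convex_lmodType E)) (f : convex_lmodType E -> K) : Prop :=
  convex_function D (fun x => - f x).

Definition grad (K : realType) (d : nat) (f : 'rV[K]_d -> K) (x : 'rV[K]_d)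
    : 'rV[K]_d :=
  \row_(i < d) 'D_(delta_mx 0 i) (f : 'rV[K]_d -> K^o) x.

Definition dotp (K : realType) (d : nat) (u v : 'rV[K]_d) : K :=
  \sum_(i < d) u 0 i * v 0 i.

(* In this section [gasR] is the ideal gas constant, [Tc] and [Pc] are the
   critical temperature and pressure, [omega] is the acentric factor. *)
Section PengRobinson.
Variable K : realType.
Implicit Types gasR Tc Pc omega T : K.

(* [dec i f g] is the decimal number whose integer part is [i] and whose six
   decimals are the groups of three [f] then [g]: [dec 0 77 800] is 0.077800.
   Unary [nat] makes six-digit literals unusable. *)
Definition dec (i f g : nat) : K := i%:R + f%:R / 10 ^+ 3 + g%:R / 10 ^+ 6.

Definition pr_m omega : K :=
  if omega <= dec 0 490 0 then
    dec 0 374 640 + dec 1 542 260 * omega - dec 0 269 920 * omega ^+ 2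
  else
    dec 0 379 642 + dec 1 485 30 * omega
      - dec 0 164 423 * omega ^+ 2 + dec 0 16 666 * omega ^+ 3.

Definition pr_beta1 omega : K :=
  - (10 ^- 16 / (dec 1 232 600 + dec 1 375 700 * omega)).

Definition pr_beta2 omega : K :=
  10 ^- 16 / (dec 0 905 100 + dec 1 541 0 * omega).

(* The value of [omega] at which the denominators of [pr_beta1] and [pr_beta2]
   agree (about 1.98): beyond it [pr_beta1 omega + pr_beta2 omega < 0], and the
   influence parameter is negative at low temperature. *)
Definition acentric_max : K := 3275 / 1653.

Definition energy_parameter gasR Tc Pc omega T : K :=
  dec 0 457 240 * (gasR ^+ 2 * Tc ^+ 2 / Pc)
    * (1 + pr_m omega * (1 - Num.sqrt (T / Tc))) ^+ 2.

Definition covolume gasR Tc Pc : K := dec 0 77 800 * (gasR * Tc / Pc).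

Definition influence_parameter gasR Tc Pc omega T : K :=
  energy_parameter gasR Tc Pc omega T * covolume gasR Tc Pc `^ (2 / 3)
    * (pr_beta1 omega * (1 - T / Tc) + pr_beta2 omega).

(* Value at the point [x] of the gradient contribution; [T] is the local
   temperature there, [n] the molar density field. *)
Definition gradient_energy gasR Tc Pc omega (d : nat)
    (n : 'rV[K]_d -> K) T (x : 'rV[K]_d) : K :=
  1 / 2 * influence_parameter gasR Tc Pc omega T * dotp (grad n x) (grad n x).

(* An interval of temperatures when [0 < pr_m omega] and [pr_beta1 omega < 0],
   although the definition does not say so. *)
Definition concavity_range Tc omega : set K :=
  [set T | 0 < T /\
    (1 + pr_m omega) * (pr_beta1 omega * (1 - T / Tc) + pr_beta2 omega)
    + 4 * pr_beta1 omega * (T / Tc)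
        * (1 + pr_m omega * (1 - Num.sqrt (T / Tc))) <= 0].

End PengRobinson.

(* Main.v *)
Require Import Defs.
From HB Require Import structures.
From mathcomp Require Import all_boot all_order all_algebra.
From mathcomp Require Import all_classical all_reals all_analysis.
From mathcomp Require Import ring lra.
Import Order.TTheory GRing.Theory Num.Theory.
Import numFieldNormedType.Exports.

Set Implicit Arguments.
Unset Strict Implicit.
Unset Printing Implicit Defensive.

Local Open Scope classical_set_scope.
Local Open Scope ring_scope.

(** Convexity in the density: at fixed temperature and position, the gradient
    contribution is a nonnegative multiple of the square norm of the gradient,
    and the gradient is linear in the density.  The multiple is nonnegative as
    soon as [beta1 (1 - Tr) + beta2] is; below [acentric_max] one has
    [beta1 + beta2 >= 0], and [- beta1 Tr > 0] does the rest.

    Concavity in the temperature: put [s = sqrt Tr].  Up to a nonnegative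
    constant, the influence parameter is the polynomial
    [profile s = (1 + m (1 - s))^2 (b1 (1 - s^2) + b2)], and differentiating
    twice with respect to [t = s^2] gives
    [profile'' = m / (2 s^3) * curvature s], where [curvature s] is the left
    side of the inequality that defines the concavity range.  Thus concavity on
    that range is the second derivative test, provided that the range is
    convex.

    The range is convex because [curvature] itself is convex as a function of
    [t]: it is an affine function of [t] plus [- 4 b1 m t^(3/2)] with [b1 < 0].
    So the range is a sublevel set of a convex function
    ([convex_concavity_range]).

    No derivative in the temperature is taken below.  Concavity is shown by
    exhibiting a supporting line at each point: the gap between [profile] and
    its tangent is [(s - s0)^2] times an expression which turns out to be a
    positive combination of [curvature s0] and [curvature s], plus a nonpositive
    term ([profile_tangent_gap]).  Both curvatures are nonpositive on the range,
    hence the sign of the gap. *)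

(** * Convexity by supporting lines *)

Lemma conv_lmodE (K : realType) (E : lmodType K) (x y : convex_lmodType E)
    (t : {i01 K}) :
  conv t x y = t%:num *: (x : E) + (1 - t%:num) *: (y : E).
Proof. by []. Qed.

(** At the point [z] between [x] and [y], average the two inequalities that the
    supporting line at [z] gives: the linear terms cancel. *)
Lemma convex_function_of_support (K : realType)
    (D : set (convex_lmodType K^o)) (f : K -> K) :
  convex_set D ->
  (forall z, D z -> exists c, forall y, D y -> f z + c * (y - z) <= f y) ->
  convex_function D f.
Proof.
move=> Dconv supp t x y xD yD.
have /set_mem /supp[c cP] := Dconv x y t xD yD.
have /cP := set_mem xD; have /cP := set_mem yD.
rewrite !conv_lmodE; set z := t%:num *: _ + _.
have t0 : 0 <= t%:num by [].
have t1 : 0 <= 1 - t%:num by [].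
move=> /(ler_wpM2l t1) fy /(ler_wpM2l t0) fx.
apply: le_trans (lerD fx fy).
set rhs := (X in _ <= X).
suff -> : rhs = f z by exact: lexx.
by rewrite /rhs /z /GRing.scale /=; ring.
Qed.

Lemma convex_set_sublevel (K : realType) (D : set (convex_lmodType K^o))
    (f : K -> K) (a : K) :
  convex_set D -> convex_function D f -> convex_set (D `&` [set x | f x <= a]).
Proof.
move=> Dconv fconv x y t /set_mem[/mem_set xD fx] /set_mem[/mem_set yD fy].
apply/mem_set; split; first exact/set_mem/Dconv.
apply: (le_trans (fconv t x y xD yD)).
rewrite [X in X <= _](@conv_lmodE K K^o).
have t0 : 0 <= t%:num by [].
have t1 : 0 <= 1 - t%:num by [].
apply: (le_trans (lerD (ler_wpM2l t0 fx) (ler_wpM2l t1 fy))).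
by rewrite -mulrDl addrC subrK mul1r.
Qed.

Lemma convex_set_gt0 (K : realType) :
  convex_set ([set x : K | 0 < x] : set (convex_lmodType K^o)).
Proof.
by move=> x y t /set_mem x0 /set_mem y0; apply/mem_set/convR_gt0.
Qed.

(** * The influence parameter as a function of the root of Tr *)

Section ReducedProfile.
Variables (K : realType) (m b1 b2 : K).
Implicit Types s : K.

Definition attraction s : K := 1 + m * (1 - s).

Definition influence_factor s : K := b1 * (1 - s ^+ 2) + b2.

Definition profile s : K := attraction s ^+ 2 * influence_factor s.

(** Equal to [2 s^3 / m] times the second derivative of [profile] with respect
    to [s ^+ 2]. *)
Definition curvature s : K :=
  (1 + m) * influence_factor s + 4 * b1 * s ^+ 2 * attraction s.

(** The derivative of [profile] with respect to [s ^+ 2]. *)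
Definition profile_slope s : K :=
  - (attraction s * (m * influence_factor s / s + b1 * attraction s)).

(** As a function of [t = s ^+ 2], [curvature] is affine but for the term
    [- 4 b1 m t^(3/2)], which is convex when [m > 0] and [b1 < 0]. *)
Lemma curvature_tangent s0 s : 0 < m -> b1 < 0 -> 0 < s0 -> 0 < s ->
  curvature s0 + 3 * b1 * (1 + m - 2 * m * s0) * (s ^+ 2 - s0 ^+ 2)
    <= curvature s.
Proof.
move=> m_gt0 b1_lt0 s0_gt0 s_gt0; rewrite -subr_ge0.
(* The last factor is the gap between s^3 and its tangent in s^2 at s0. *)
have -> : curvature s
    - (curvature s0 + 3 * b1 * (1 + m - 2 * m * s0) * (s ^+ 2 - s0 ^+ 2))
    = - (4 * b1 * m) * ((s - s0) ^+ 2 * (s + s0 / 2)).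
  by rewrite /curvature /attraction /influence_factor; field.
apply: mulr_ge0; first by nra.
by apply: mulr_ge0; [exact: sqr_ge0 | lra].
Qed.

(** Expanding the gap gives [m (s - s0)^2 G / s0], where [G] is
    [(1 + m) (b1 + b2) + b1 s0 ((1 + m) (2 s + s0) - m (s + s0)^2)].  Replacing
    [G] by the average of [curvature s0] and [curvature s] in which the second
    has weight [2 s0 / (3 (s + s0))] makes the terms in [1 + m] agree.  What
    remains is divisible by [(s - s0)^2] once more. *)
Lemma profile_tangent_gap s0 s : s0 != 0 ->
  3 * (s + s0) * s0
    * (profile s - (profile s0 + profile_slope s0 * (s ^+ 2 - s0 ^+ 2)))
  = m * (s - s0) ^+ 2
    * ((3 * s + s0) * curvature s0 + 2 * s0 * curvature s
       + m * b1 * s0 * (s - s0) ^+ 2 * (5 * s + s0)).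
Proof.
move=> s0_neq0.
rewrite /profile_slope /profile /curvature /attraction /influence_factor.
by field.
Qed.

(** The sign of the curvature at the two ends suffices: every term on the right
    of [profile_tangent_gap] is then nonpositive. *)
Lemma profile_tangent s0 s : 0 < m -> b1 < 0 -> 0 < s0 -> 0 < s ->
  curvature s0 <= 0 -> curvature s <= 0 ->
  profile s <= profile s0 + profile_slope s0 * (s ^+ 2 - s0 ^+ 2).
Proof.
move=> m_gt0 b1_lt0 s0_gt0 s_gt0 curv0 curv; rewrite -subr_le0.
have den_gt0 : 0 < 3 * (s + s0) * s0 by rewrite !mulr_gt0 ?addr_gt0.
rewrite -(pmulr_rle0 _ den_gt0) profile_tangent_gap ?gt_eqF//.
apply: mulr_ge0_le0; first by rewrite mulr_ge0 ?sqr_ge0// ltW.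
have e1 : (3 * s + s0) * curvature s0 <= 0 by apply: mulr_ge0_le0 => //; lra.
have e2 : 2 * s0 * curvature s <= 0 by apply: mulr_ge0_le0 => //; lra.
have e3 : m * b1 * s0 * (s - s0) ^+ 2 * (5 * s + s0) <= 0.
  apply: mulr_le0_ge0; last by lra.
  apply: mulr_le0_ge0; last exact: sqr_ge0.
  by apply: mulr_le0_ge0; [nra | exact: ltW].
lra.
Qed.

End ReducedProfile.

Lemma temperatureE (K : realType) (Tc T : K) : 0 < Tc -> 0 < T ->
  T = Tc * Num.sqrt (T / Tc) ^+ 2.
Proof.
by move=> Tc0 T0; rewrite sqr_sqrtr ?divr_ge0 ?ltW// mulrC divfK ?gt_eqF.
Qed.

(** The temperature-independent factor of the influence parameter. *)
Definition influence_scale (K : realType) (gasR Tc Pc : K) : K :=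
  dec K 0 457 240 * (gasR ^+ 2 * Tc ^+ 2 / Pc) * covolume gasR Tc Pc `^ (2 / 3).

Lemma dec_ge0 (K : realType) (i f g : nat) : 0 <= dec K i f g.
Proof. by rewrite /dec !addr_ge0 ?divr_ge0 ?exprn_ge0 ?ler0n. Qed.

Lemma influence_scale_ge0 (K : realType) (gasR Tc Pc : K) :
  0 < gasR -> 0 < Tc -> 0 < Pc -> 0 <= influence_scale gasR Tc Pc.
Proof.
move=> R0 T0 P0; rewrite /influence_scale.
rewrite mulr_ge0 ?powR_ge0// mulr_ge0 ?dec_ge0//.
by rewrite ltW// divr_gt0// mulr_gt0// exprn_gt0.
Qed.

Lemma influence_parameterE (K : realType) (gasR Tc Pc omega T : K) :
  0 < Tc -> 0 < T ->
  influence_parameter gasR Tc Pc omega T =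
  influence_scale gasR Tc Pc
  * profile (pr_m omega) (pr_beta1 omega) (pr_beta2 omega) (Num.sqrt (T / Tc)).
Proof.
move=> Tc0 T0.
rewrite /influence_parameter /energy_parameter /influence_scale /profile.
by rewrite /influence_factor sqr_sqrtr ?ltW ?divr_gt0// /attraction; ring.
Qed.

(** * Concavity in the temperature *)

Lemma concavity_rangeE (K : realType) (Tc omega : K) : 0 < Tc ->
  concavity_range Tc omega =
  [set T | 0 < T] `&` [set T | curvature (pr_m omega) (pr_beta1 omega)
    (pr_beta2 omega) (Num.sqrt (T / Tc)) <= 0].
Proof.
move=> Tc0; apply/seteqP; split=> T /= [T0 hT]; split=> //; move: hT;
by rewrite /curvature /influence_factor /attraction sqr_sqrtr// ltW ?divr_gt0.
Qed.

(** The range is a sublevel set of the curvature, which is convex in [T]. *)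
Lemma convex_concavity_range (K : realType) (Tc omega : K) : 0 < Tc ->
  0 < pr_m omega -> pr_beta1 omega < 0 ->
  convex_set (concavity_range Tc omega : set (convex_lmodType K^o)).
Proof.
move=> Tc0 m0 b0; rewrite concavity_rangeE//.
apply: convex_set_sublevel; first exact: convex_set_gt0.
apply: convex_function_of_support; first exact: convex_set_gt0.
move=> T0 /= T0p; set s0 := Num.sqrt (T0 / Tc).
(* The slope of curvature_tangent, which is relative to Tr, divided by Tc. *)
exists (3 * pr_beta1 omega * (1 + pr_m omega - 2 * pr_m omega * s0) / Tc).
move=> T Tp; set s := Num.sqrt (T / Tc).
have s0p : 0 < s0 by rewrite sqrtr_gt0 divr_gt0.
have sp : 0 < s by rewrite sqrtr_gt0 divr_gt0.
have -> : T - T0 = Tc * (s ^+ 2 - s0 ^+ 2).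
  by rewrite mulrBr -!temperatureE.
rewrite mulrA divfK ?gt_eqF//.
exact: curvature_tangent.
Qed.

Lemma dotp_ge0 (K : realType) (d : nat) (u : 'rV[K]_d) : 0 <= dotp u u.
Proof. by apply: sumr_ge0 => i _; rewrite -expr2 sqr_ge0. Qed.

(** The supporting lines are the tangents of [profile_tangent], rescaled from
    the variable [Tr] to [T] and by the temperature-independent factor. *)
Lemma concave_gradient_energy (K : realType) (d : nat) (gasR Tc Pc omega : K)
    (n : 'rV[K]_d -> K) (x : 'rV[K]_d) :
  0 < gasR -> 0 < Tc -> 0 < Pc -> 0 < pr_m omega -> pr_beta1 omega < 0 ->
  concave_function (concavity_range Tc omega : set (convex_lmodType K^o))
    (fun T => gradient_energy gasR Tc Pc omega n T x).
Proof.
move=> R0 Tc0 P0 m0 b0; rewrite /concave_function.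
apply: convex_function_of_support; first exact: convex_concavity_range.
rewrite concavity_rangeE// => T0 [/= T0p curv0].
rewrite /gradient_energy.
set g := dotp _ _; set s0 := Num.sqrt (T0 / Tc) in curv0 *.
pose C := 1 / 2 * influence_scale gasR Tc Pc * g.
have C0 : 0 <= C.
  apply: mulr_ge0; last exact: dotp_ge0.
  by apply: mulr_ge0; [lra | exact: influence_scale_ge0].
pose q := profile_slope (pr_m omega) (pr_beta1 omega) (pr_beta2 omega) s0.
exists (- (C * q / Tc)).
move=> T [/= Tp curv]; rewrite !influence_parameterE// -/s0.
set s := Num.sqrt (T / Tc) in curv *.
have s0p : 0 < s0 by rewrite sqrtr_gt0 divr_gt0.
have sp : 0 < s by rewrite sqrtr_gt0 divr_gt0.
have -> : T - T0 = Tc * (s ^+ 2 - s0 ^+ 2).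
  by rewrite mulrBr -!temperatureE.
have -> : - (C * q / Tc) * (Tc * (s ^+ 2 - s0 ^+ 2))
    = - (C * (q * (s ^+ 2 - s0 ^+ 2))).
  by field; rewrite gt_eqF.
have := ler_wpM2l C0 (profile_tangent m0 b0 s0p sp curv0 curv).
by rewrite -/q -opprD lerN2 mulrDr; congr (_ <= _ + _); rewrite /C; ring.
Qed.

(** * Convexity in the density *)

(** Both denominators are positive, so the sign of the sum is that of the
    difference between the denominator of [pr_beta1] and that of [pr_beta2],
    [0.3275 - 0.1653 omega]. *)
Lemma pr_beta_sum_ge0 (K : realType) (omega : K) :
  pr_beta1 omega < 0 -> 0 < pr_beta2 omega -> omega <= acentric_max K ->
  0 <= pr_beta1 omega + pr_beta2 omega.
Proof.
rewrite /pr_beta1 /pr_beta2 /acentric_max; set e : K := 10 ^- 16.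
have e0 : 0 < e by rewrite invr_gt0 exprn_gt0.
rewrite oppr_lt0 !pmulr_rgt0// !invr_gt0 => D1 D2 le_omega.
rewrite addrC subr_ge0 ler_pM2l// lef_pV2 ?posrE//.
rewrite /dec; lra.
Qed.

Lemma influence_parameter_ge0 (K : realType) (gasR Tc Pc omega T : K) :
  0 < gasR -> 0 < Tc -> 0 < Pc -> 0 < T ->
  0 <= pr_beta1 omega * (1 - T / Tc) + pr_beta2 omega ->
  0 <= influence_parameter gasR Tc Pc omega T.
Proof.
move=> R0 Tc0 P0 T0 q0; rewrite influence_parameterE//.
rewrite mulr_ge0 ?influence_scale_ge0// mulr_ge0 ?sqr_ge0//.
by rewrite /influence_factor sqr_sqrtr// ltW ?divr_gt0.
Qed.

Lemma grad_linear_comb (K : realType) (d : nat) (n1 n2 : 'rV[K]_d -> K^o)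
    (x : 'rV[K]_d) (a b : K) :
  differentiable n1 x -> differentiable n2 x ->
  grad (a \*: n1 + b \*: n2) x = a *: grad n1 x + b *: grad n2 x.
Proof.
move=> d1 d2; apply/rowP => i; rewrite !mxE.
rewrite deriveD; [|by apply: derivableZ; exact: diff_derivable..].
by rewrite !deriveZ; [|exact: diff_derivable..].
Qed.

(** Coordinatewise, the defect of convexity of the square is
    [t (1 - t) (u i - v i)^2]. *)
Lemma dotp_conv_le (K : realType) (d : nat) (u v : 'rV[K]_d) (t : {i01 K}) :
  dotp (t%:num *: u + (1 - t%:num) *: v) (t%:num *: u + (1 - t%:num) *: v)
  <= t%:num * dotp u u + (1 - t%:num) * dotp v v.
Proof.
rewrite /dotp !mulr_sumr -big_split /=; apply: ler_sum => i _; rewrite !mxE.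
have t0 : 0 <= t%:num by [].
have t1 : 0 <= 1 - t%:num by [].
rewrite -subr_ge0.
have := mulr_ge0 (mulr_ge0 t0 t1) (sqr_ge0 (u 0 i - v 0 i)).
by congr (_ <= _); ring.
Qed.

Lemma convex_gradient_energy (K : realType) (d : nat) (gasR Tc Pc omega T : K)
    (x : 'rV[K]_d) :
  0 <= influence_parameter gasR Tc Pc omega T ->
  convex_function
    ([set n | differentiable n x] : set (convex_lmodType ('rV[K]_d -> K^o)))
    (fun n => gradient_energy gasR Tc Pc omega n T x).
Proof.
move=> c0 t n1 n2 /set_mem d1 /set_mem d2; rewrite /gradient_energy.
rewrite [in X in X <= _](conv_lmodE n1 n2) (grad_linear_comb _ _ d1 d2).
rewrite [X in _ <= X](@conv_lmodE K K^o).
set C := 1 / 2 * _.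
have C0 : 0 <= C by rewrite mulr_ge0// divr_ge0.
apply: le_trans (ler_wpM2l C0 (dotp_conv_le _ _ t)) _.
set u := dotp _ _; set v := dotp _ _.
suff -> : C * (t%:num * u + (1 - t%:num) * v)
    = t%:num * (C * u) + (1 - t%:num) * (C * v) by exact: lexx.
by ring.
Qed.

Theorem lemma4p2 (K : realType) (d : nat) (gasR Tc Pc omega : K)
    (gasR_gt0 : 0 < gasR) (Tc_gt0 : 0 < Tc) (Pc_gt0 : 0 < Pc)
    (m_gt0 : 0 < pr_m omega) (beta1_lt0 : pr_beta1 omega < 0)
    (beta2_gt0 : 0 < pr_beta2 omega) :
  (forall (T : K) (x : 'rV[K]_d), 0 < T ->
     (omega <= acentric_max K \/
      0 <= pr_beta1 omega * (1 - T / Tc) + pr_beta2 omega) ->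
     convex_function
       ([set n | differentiable n x] : set (convex_lmodType ('rV[K]_d -> K^o)))
       (fun n => gradient_energy gasR Tc Pc omega n T x))
  /\
  convex_set (concavity_range Tc omega : set (convex_lmodType K^o))
  /\
  (forall (n : 'rV[K]_d -> K^o) (x : 'rV[K]_d), differentiable n x ->
     concave_function
       (concavity_range Tc omega : set (convex_lmodType K^o))
       (fun T => gradient_energy gasR Tc Pc omega n T x)).
Proof.
split; [|split].
- move=> T x T0 omegaT; apply: convex_gradient_energy.
  apply: influence_parameter_ge0 => //; case: omegaT => // le_omega.
  have b0 := pr_beta_sum_ge0 beta1_lt0 beta2_gt0 le_omega.
  (* The term - beta1 Tr is positive, so only beta1 + beta2 matters. *)
  have bt : pr_beta1 omega * (T / Tc) <= 0.
    by rewrite mulr_le0_ge0 ?ltW ?divr_gt0.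
  lra.
- exact: convex_concavity_range.
- by move=> n x _; exact: concave_gradient_energy.
Qed.
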